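(* Let $d$ be a positive odd integer divisible by $3$, let $r$ be a positive odd integer, let $a$ be an integer with $a\equiv 1\pmod{12}$, and let $b=2^d a-3^r$. Then the equation $$ax^d-y^2-z^2+xyz-b=0$$ has no solution $(x,y,z)\in\mathbb{Z}^3$ with $x$ even. *)

(* Defs.v *)
From mathcomp Require Import all_boot all_order all_algebra.

Set Implicit Arguments.
Unset Strict Implicit.
Unset Printing Implicit Defensive.

(* Main.v *)
(* Modulo 4, a solution with x = 2t gives y^2 + z^2 - 2tyz = 3, as both terms
   a x^d and 2^d a vanish (d >= 2) and 3^r = 3 (r odd). The left-hand side is odd
   only if exactly one of y, z is odd, and then it is 1 modulo 4. *)
Require Import Defs.
From mathcomp Require Import all_boot all_order all_algebra.
From mathcomp Require Import zify ring.

Import Order.TTheory GRing.Theory Num.Theory.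
Local Open Scope ring_scope.

Lemma int_even_or_odd (n : int) : exists m : int, n = 2 * m \/ n = 2 * m + 1.
Proof. by exists (n %/ 2)%Z; lia. Qed.

Lemma sqr_add_sqr_sub_even_mul_neq3 (t y z n : int) :
  y ^+ 2 + z ^+ 2 - 2 * t * y * z <> 4 * n + 3.
Proof.
(* After expansion, a linear argument modulo 4 with the monomials as unknowns settles each parity
   case. *)
have [u [->|->]] := int_even_or_odd y; have [v [->|->]] := int_even_or_odd z; lia.
Qed.

Lemma exp3_odd_mod4 (r : nat) : odd r -> exists k : int, 3 ^+ r = 4 * k + 3.
Proof.
move=> r_odd; rewrite -(odd_double_half r) r_odd.
elim: r./2 => [|m [k IHm]]; first by exists 0.
(* [9 * (4 * k + 3) = 4 * (9 * k + 6) + 3]. *)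
exists (9 * k + 6); rewrite doubleS addnS addnS 2!exprS IHm; ring.
Qed.

Theorem corollary2p1 (d r : nat) (a b : int)
    (d_gt0 : (0 < d)%N) (d_odd : odd d) (d_dvd3 : (3 %| d)%N)
    (r_gt0 : (0 < r)%N) (r_odd : odd r)
    (a_mod12 : (a = 1 %[mod 12])%Z)
    (b_def : b = 2 ^+ d * a - 3 ^+ r) :
  ~ exists x y z : int,
      (2 %| x)%Z /\
      a * x ^+ d - y ^+ 2 - z ^+ 2 + x * y * z - b = 0.
Proof.
move=> [x [y [z [/dvdzP[t ->] eq0]]]].
(* A positive multiple of 3 is at least 3, so [2 ^+ d] contains the factor 4. *)
have [e d_eq] : exists e, d = e.+2 by exists d.-2; lia.
have [k r_eq] := exp3_odd_mod4 r r_odd.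
rewrite b_def r_eq d_eq exprMn !(exprS 2) in eq0.
(* With [x = t * 2], [a * x ^+ d - b] is [2 ^+ d * a * (t ^+ d - 1) + 3 ^+ r]; the witness is its
   quotient by 4. *)
apply: (sqr_add_sqr_sub_even_mul_neq3 t y z
          (a * 2 ^+ e * (t ^+ e.+2 - 1) + k)).
apply/esym/eqP; rewrite -subr_eq0 -eq0; apply/eqP; ring.
Qed.
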